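(* Let $n, K, M \ge 1$ be integers with $n = KM$, and consider the non-corrupted parallel mixnet (buffer shuffling) process on $n$ cards with $M$ servers, each shuffling $K$ cards per round, with potential $\Phi(t)=\left(\sum_{i=1}^n w_i(t)^2\right)-\frac1n$ after $t$ rounds. Then for every integer $t\ge 0$, $$\mathbf{E}[\Phi(t)] \le K^{-t}.$$ In particular, if $K \ge n^{1/c}$ for a constant $c\ge 1$, then for any fixed $b\ge 1$, after $t=\lceil bc\rceil$ rounds the expected sum-of-squares error between the card-assignment probabilities and the uniform distribution satisfies $\mathbf{E}[\Phi(t)] \le 1/n^b$.
   Context: Buffer shuffling / non-corrupted parallel mixnet: there are $n$ cards (messages). In each round, (1) the cards are placed in order according to a uniformly random permutation, independent of all previous randomness, which the adversary sees; (2) under this ordering the cards are divided into $M=n/K$ consecutive groups of $K$ cards (one group per server); (3) within each group the $K$ cards are permuted uniformly at random, hidden from the adversary. The adversary knows the initial ordering. $w_i(t)$ is the probability, from the point of view of the adversary (i.e. given the visible permutations of rounds $1,\dots,t$), that the card in position $i$ after $t$ rounds is the card that was first at time $0$. Concretely, $w(0)=(1,0,\dots,0)$, and $w(t+1)$ is obtained from $w(t)$ by permuting the entries by a fresh uniformly random permutation of the $n$ positions, splitting the positions into $M$ consecutive blocks of size $K$, and replacing every entry in each block by the average of the $K$ entries of that block. The sum-of-squares metric is $\Phi(t)=\sum_{i=1}^n (w_i(t)-1/n)^2 = \left(\sum_{i=1}^n w_i(t)^2\right)-1/n$. It is a random variable depending on the visible random permutations; $\mathbf{E}$ is expectation over these.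 *)

(* Defs.v *)
From HB Require Import structures.
From mathcomp Require Import all_boot all_order all_algebra all_fingroup.
From mathcomp Require Import ring.

Set Implicit Arguments.
Unset Strict Implicit.
Unset Printing Implicit Defensive.

Import Order.TTheory GRing.Theory Num.Theory.
Local Open Scope ring_scope.

(* One round of buffer shuffling sends a card at position [p] to position
   [q.2 (q.1 p)]: [q.1] is the ordering seen by the adversary and [q.2] the
   hidden shuffle. *)
Definition round (n : nat) : finType := ('S_n * 'S_n)%type.

(* The [M] servers hold the consecutive groups of positions with the same
   quotient by [K].  A uniform element of this set amounts to independent
   uniform permutations of the groups. *)
Definition group_shuffles (n K : nat) : {set 'S_n} :=
  [set h : 'S_n | [forall i : 'I_n, (h i %/ K == i %/ K)%N]].

(* Sample space of [t] independent rounds, with the uniform probability. *)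
Definition runs (n K t : nat) : {set t.-tuple (round n)} :=
  [set r : t.-tuple (round n) | all (fun q => q.2 \in group_shuffles n K) r].

Definition Pr (R : realFieldType) (n K t : nat)
    (A : {set t.-tuple (round n)}) : R :=
  #|runs n K t :&: A|%:R / #|runs n K t|%:R.

Definition expectation (R : realFieldType) (n K t : nat)
    (X : t.-tuple (round n) -> R) : R :=
  (\sum_(r in runs n K t) X r) / #|runs n K t|%:R.

Definition position (n : nat) (r : seq (round n)) (p : 'I_n) : 'I_n :=
  foldl (fun (x : 'I_n) (q : round n) => q.2 (q.1 x)) p r.

Definition first_card_at (n t : nat) (i : 'I_n) : {set t.-tuple (round n)} :=
  [set r : t.-tuple (round n) |
    [exists p : 'I_n, (val p == 0%N) && (position r p == i)]].

Definition view (n t : nat) (r : t.-tuple (round n)) : t.-tuple 'S_n :=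
  [tuple of map fst r].

Definition view_is (n t : nat) (v : t.-tuple 'S_n) :
    {set t.-tuple (round n)} := [set r | view r == v].

(* [w_i(t)]: conditional probability, given the visible orderings [v], that the
   card initially first is at position [i]; [posterior0] and [posterior_step]
   give its recursive description. *)
Definition posterior (R : realFieldType) (n K t : nat) (v : t.-tuple 'S_n)
    (i : 'I_n) : R :=
  Pr R K (first_card_at t i :&: view_is v) / Pr R K (view_is v).

Definition potential (R : realFieldType) (n : nat) (w : 'I_n -> R) : R :=
  (\sum_(i < n) w i ^+ 2) - n%:R^-1.

(* [Phi(t)], as a random variable on the sample space. *)
Definition Phi (R : realFieldType) (n K t : nat) (r : t.-tuple (round n)) : R :=
  potential (posterior R K (view r)).

Section Theory.
Variable R : realFieldType.

Lemma potentialE n (w : 'I_n -> R) : \sum_i w i = 1 ->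
  potential w = \sum_(i < n) (w i - n%:R^-1) ^+ 2.
Proof.
case: n w => [|n] w w1.
  by move: w1; rewrite big_ord0 => /esym/eqP; rewrite oner_eq0.
rewrite (eq_bigr (fun i =>
    w i ^+ 2 + (- 2 * n.+1%:R^-1 * w i + n.+1%:R^-1 ^+ 2)));
  last by move=> i _; ring.
rewrite !big_split /= -mulr_sumr w1 sumr_const card_ord -mulr_natl /potential.
by field; rewrite nat1r pnatr_eq0.
Qed.

Definition compat n K t (v : t.-tuple 'S_n) := runs n K t :&: view_is v.
Definition compat_at n K t (v : t.-tuple 'S_n) i := compat K v :&: first_card_at t i.

Lemma id_group_shuffle n K : (1%g : 'S_n) \in group_shuffles n K.
Proof. by rewrite inE; apply/forallP => i; rewrite perm1. Qed.

Lemma group_shuffles_gt0 n K : (0 < #|group_shuffles n K|)%N.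
Proof. by apply/card_gt0P; exists 1%g; exact: id_group_shuffle. Qed.

Lemma compat_gt0 n K t (v : t.-tuple 'S_n) : (0 < #|compat K v|)%N.
Proof.
apply/card_gt0P; exists [tuple of map (fun p => (p, 1%g) : round n) v].
rewrite !inE; apply/andP; split.
  by apply/allP => q /mapP[p _ ->]; exact: id_group_shuffle.
by apply/eqP/val_inj; rewrite /= -map_comp map_id_in.
Qed.

Lemma runs_gt0 n K t : (0 < #|runs n K t|)%N.
Proof.
apply: leq_trans (compat_gt0 K [tuple of nseq t 1%g] : (0 < #|compat (n := n) K _|)%N) _.
by rewrite subset_leq_card // subsetIl.
Qed.

Lemma posteriorE n K t (v : t.-tuple 'S_n) i :
  posterior R K v i = #|compat_at K v i|%:R / #|compat K v|%:R.
Proof.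
rewrite /posterior /Pr /compat_at /compat setIA (setIAC _ _ (view_is v)).
have := runs_gt0 n K t; have := compat_gt0 K v; rewrite /compat => h1 h2.
by field; rewrite !pnatr_eq0 -!lt0n h1 h2.
Qed.

Lemma posterior_sum n K t (v : t.-tuple 'S_n) : (0 < n)%N ->
  \sum_i posterior R K v i = 1.
Proof.
move=> n0; under eq_bigr do rewrite posteriorE.
rewrite -mulr_suml -natr_sum; set s := (\sum_i _)%N.
suff -> : s = #|compat K v| by rewrite divff // pnatr_eq0 -lt0n compat_gt0.
rewrite /s; under eq_bigr do rewrite -sum1_card.
rewrite -sum1_card.
rewrite (partition_big (fun r : t.-tuple (round n) => position r (Ordinal n0)) xpredT) //=.
apply: eq_bigr => i _; apply: eq_bigl => r; rewrite in_setI; congr (_ && _).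
rewrite inE; apply/existsP/idP => [[p /andP[/eqP p0]]|h].
  by have -> : p = Ordinal n0 by apply/val_inj.
by exists (Ordinal n0); rewrite eqxx.
Qed.

Lemma Phi_errorE n K t (r : t.-tuple (round n)) : (0 < n)%N ->
  Phi R K r = \sum_(i < n) (posterior R K (view r) i - n%:R^-1) ^+ 2.
Proof. by move=> n0; rewrite /Phi potentialE // posterior_sum. Qed.

Lemma posterior0 n K (v : 0.-tuple 'S_n) i :
  posterior R K v i = (val i == 0%N)%:R.
Proof.
have c1 (A : {set 0.-tuple (round n)}) : #|A| = ([tuple] \in A).
  rewrite -sum1_card big_mkcond (big_pred1 [tuple]) => [|r]; first by case: (_ \in _).
  by apply/esym/eqP/val_inj; case: r => -[].
rewrite posteriorE !c1 /compat_at (in_setI _ _ (first_card_at 0 i)).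
have -> : [tuple] \in compat K v by rewrite !inE /= [v]tuple0; apply/eqP/val_inj.
rewrite divr1 inE /=; congr (nat_of_bool _)%:R.
apply/existsP/idP => [[p /andP[/eqP p0 /eqP <-]]|h]; first by rewrite /= p0.
by exists i; rewrite h /=.
Qed.

Lemma card_group n K M (m : nat) : (0 < K)%N -> n = (K * M)%N -> (m < M)%N ->
  #|[set i : 'I_n | (i %/ K == m)%N]| = K.
Proof.
move=> K0 nE mM.
have lt (k : 'I_K) : (m * K + k < n)%N.
  rewrite nE; apply: (@leq_trans (m.+1 * K)); first by rewrite mulSn addnC ltn_add2r.
  by rewrite mulnC leq_mul2l mM orbT.
have fi : injective (fun k => Ordinal (lt k)).
  by move=> a b [/addnI ab]; apply/val_inj.
rewrite -[RHS]card_ord -(card_imset _ fi); apply: eq_card => i.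
rewrite inE; apply/eqP/imsetP => [h|[k _ ->]] /=.
  by exists (Ordinal (ltn_pmod i K0)) => //; apply/val_inj; rewrite /= -h -divn_eq.
by rewrite divnMDl // divn_small // addn0.
Qed.

Lemma card_shuffle_to n K M (a i : 'I_n) : (0 < K)%N -> n = (K * M)%N ->
  (#|[set h in group_shuffles n K | h a == i]| * K =
   (a %/ K == i %/ K) * #|group_shuffles n K|)%N.
Proof.
move=> K0 nE; case: eqVneq => [ai|nai]; last first.
  rewrite mul0n; apply/eqP; rewrite muln_eq0 cards_eq0; apply/orP; left.
  apply/eqP/setP => h; rewrite !inE; apply/negP => /andP[/forallP /(_ a) /eqP ha /eqP hi].
  by move: nai; rewrite -hi ha eqxx.
rewrite mul1n; set c := fun j : 'I_n => #|[set h in group_shuffles n K | h a == j]|.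
have cE (j : 'I_n) : (j %/ K == a %/ K)%N -> c j = c i.
  move=> /eqP ja; rewrite /c.
  rewrite -(card_imset _ (mulIg (tperm j i))); apply: eq_card => h.
  have tK (x : 'I_n) : (tperm j i x %/ K = x %/ K)%N.
    by case: tpermP => [->|->|//]; rewrite ja ai.
  apply/imsetP/idP => [[g]|].
    rewrite !inE => /andP[/forallP gb /eqP ga] ->; apply/andP; split; last by rewrite permM ga tpermL.
    by apply/forallP => x; rewrite permM tK.
  rewrite !inE => /andP[/forallP hb /eqP ha]; exists (h * tperm j i)%g; last first.
    by rewrite -mulgA tperm2 mulg1.
  rewrite !inE permM ha tpermR eqxx andbT.
  by apply/forallP => x; rewrite permM tK.
rewrite -[RHS]sum1_card (partition_big (fun h : 'S_n => h a) (fun j : 'I_n => j %/ K == a %/ K)%N) /=; last first.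
  by move=> h; rewrite inE => /forallP.
rewrite (eq_bigr (fun=> c i)); last first.
  by move=> j /cE <-; rewrite /c -sum1_card; apply: eq_bigl => h; rewrite !inE.
rewrite sum_nat_cond_const mulnC; congr (_ * _)%N.
have aM : (a %/ K < M)%N by rewrite ltn_divLR // mulnC -nE.
apply: etrans (esym (card_group K0 nE aM)) _.
by apply: eq_card => x; rewrite !inE.
Qed.

Lemma rcons_tuple_bij (T : finType) t :
  bijective (fun p : t.-tuple T * T => [tuple of rcons p.1 p.2]).
Proof.
apply: inj_card_bij => [[a x] [b y] /(congr1 val) /= /eqP|].
  by rewrite eqseq_rcons => /andP[/eqP ab /eqP ->]; congr (_, _); apply/val_inj.
by rewrite card_prod !card_tuple expnSr.
Qed.

Lemma compat_rcons n K t (v : t.-tuple 'S_n) pi (r : t.-tuple (round n)) q :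
  ([tuple of rcons r q] \in compat K [tuple of rcons v pi]) =
  (r \in compat K v) && ((q.2 \in group_shuffles n K) && (q.1 == pi)).
Proof.
rewrite ![_ \in compat _ _]in_setI ![_ \in runs _ _ _]inE /= all_rcons.
rewrite ![_ \in view_is _]inE -!val_eqE /= map_rcons eqseq_rcons.
by rewrite [in RHS]andbACA [X in X && _ = _]andbC.
Qed.

Lemma card_compat_rcons n K t (v : t.-tuple 'S_n) pi :
  #|compat K [tuple of rcons v pi]| = (#|compat K v| * #|group_shuffles n K|)%N.
Proof.
rewrite -sum1_card (reindex _ (onW_bij _ (rcons_tuple_bij _ _))) /=.
under eq_bigl do rewrite compat_rcons.
rewrite -(pair_big_dep (mem (compat K v)) (fun _ (q : round n) => (q.2 \in group_shuffles n K) && (q.1 == pi)) (fun _ _ => 1%N)) /=.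
rewrite sum_nat_const; congr (_ * _)%N.
rewrite -sum1_card (reindex_onto (fun h : 'S_n => (pi, h)) snd) /=;
  last by move=> [a b] /= /andP[_ /eqP ->].
by apply: eq_bigl => h; rewrite !eqxx !andbT.
Qed.

(* Each round permutes the probabilities by the visible ordering and then
   averages them within every group. *)
Lemma posterior_step n K M t (v : t.-tuple 'S_n) (pi : 'S_n) (i : 'I_n) :
  (0 < K)%N -> n = (K * M)%N ->
  posterior R K [tuple of rcons v pi] i =
    (\sum_(j < n | (j %/ K == i %/ K)%N) posterior R K v ((pi^-1)%g j)) / K%:R.
Proof.
move=> K0 nE; have n0 : (0 < n)%N by exact: leq_ltn_trans (ltn_ord i).
pose p0 := Ordinal n0.
have fE s (r : s.-tuple (round n)) j : (r \in first_card_at s j) = (position r p0 == j).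
  rewrite inE; apply/existsP/idP => [[p /andP[/eqP pz]]|h].
    by have -> : p = p0 by apply/val_inj.
  by exists p0; rewrite eqxx.
pose c (j : 'I_n) := #|[set h in group_shuffles n K | h j == i]|.
have key : #|compat_at K [tuple of rcons v pi] i|
    = (\sum_j #|compat_at K v ((pi^-1)%g j)| * c j)%N.
  rewrite -sum1_card (reindex _ (onW_bij _ (rcons_tuple_bij _ _))) /=.
  rewrite (eq_bigl (fun p : t.-tuple (round n) * round n => (p.1 \in compat K v) &&
     [&& p.2.2 \in group_shuffles n K, p.2.1 == pi & p.2.2 (p.2.1 (position p.1 p0)) == i])); last first.
    move=> p; rewrite in_setI compat_rcons fE /= /position foldl_rcons.
    by rewrite -!andbA.
  rewrite -(pair_big_dep (mem (compat K v)) (fun r (q : round n) => [&& q.2 \in group_shuffles n K, q.1 == pi & q.2 (q.1 (position r p0)) == i]) (fun _ _ => 1%N)) /=.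
  rewrite (eq_bigr (fun r : t.-tuple (round n) => c (pi (position r p0)))); last first.
    move=> r _; rewrite /c -sum1_card (reindex_onto (fun h : 'S_n => (pi, h)) snd) /=;
      last by move=> [a b] /= /and3P[_ /eqP ->].
    by apply: eq_bigl => h; rewrite !inE !eqxx !andbT.
  rewrite (partition_big (fun r : t.-tuple (round n) => pi (position r p0)) xpredT) //=.
  apply: eq_bigr => j _; rewrite (eq_bigr (fun=> c j)); last by move=> r /andP[_ /eqP ->].
  rewrite sum_nat_cond_const; congr (_ * _)%N; apply: eq_card => r.
  rewrite inE [RHS]in_setI fE; congr (_ && _).
  by rewrite -(inj_eq (@perm_inj _ pi) (position r p0)) permKV.
rewrite posteriorE key card_compat_rcons.
under [in RHS]eq_bigr do rewrite posteriorE.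
rewrite -mulr_suml natr_sum.
have H0 : #|group_shuffles n K|%:R != 0 :> R by rewrite pnatr_eq0 -lt0n group_shuffles_gt0.
have V0 : #|compat K v|%:R != 0 :> R by rewrite pnatr_eq0 -lt0n compat_gt0.
have K00 : K%:R != 0 :> R by rewrite pnatr_eq0 -lt0n.
rewrite [X in _ / X]natrM.
rewrite [in RHS]big_mkcond /= !mulr_suml; apply: eq_bigr => j _.
have := card_shuffle_to j i K0 nE => /(congr1 (fun x => x%:R : R)).
rewrite -/(c j) !natrM => cE.
have -> : (c j)%:R = (j %/ K == i %/ K)%N%:R * #|group_shuffles n K|%:R / K%:R :> R.
  by rewrite -cE mulfK.
case: (_ == _); last by rewrite !(mul0r, mulr0).
by rewrite mul1r; field; rewrite H0 V0 K00.
Qed.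

End Theory.

(* Main.v *)
(* With u = w(t) - 1/n, one round replaces u by its block averages after a
   uniform permutation s.  For j != j' the sum over s of u (s j) * u (s j') does
   not depend on the pair (j, j'), and since u has zero sum it is
   -1/(n-1) times the sum over s of u (s j) ^ 2, hence nonpositive.  Expanding
   the squared block averages and dropping the cross terms shows that a round
   divides the expected potential by at least K. *)
Require Import Defs.
From mathcomp Require Import all_boot all_order all_algebra.
From mathcomp Require Import all_fingroup ring.
From mathcomp Require Import reals exp.
Import Order.TTheory GRing.Theory Num.Theory.
Local Open Scope ring_scope.

Set Implicit Arguments.
Unset Strict Implicit.
Unset Printing Implicit Defensive.

Lemma sumr_cond_const (V : nmodType) (I : finType) (P : pred I) (x : V) :
  \sum_(i | P i) x = x *+ #|[pred i | P i]|.
Proof. by rewrite -sumr_const; apply: eq_bigl => i; rewrite inE. Qed.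

Section Contraction.
Variable R : realFieldType.

Lemma sum_perm_cross_le0 n (u : 'I_n -> R) (j k : 'I_n) :
  \sum_i u i = 0 -> j != k -> \sum_(s : 'S_n) u (s j) * u (s k) <= 0.
Proof.
move=> u0 jk; set C := \sum_(s : 'S_n) _.
(* Composing with [tperm k l] exchanges [k] and [l] and fixes [j], which differs from both, so it
   only relabels the permutations summed over. *)
have cE (l : 'I_n) : l != j -> \sum_(s : 'S_n) u (s j) * u (s l) = C.
  move=> lj; rewrite (reindex_inj (mulgI (tperm k l))) /=.
  by apply: eq_bigr => s _; rewrite !permM tpermR tpermD // eq_sym.
have rowsum0 : \sum_l \sum_(s : 'S_n) u (s j) * u (s l) = 0.
  rewrite exchange_big big1 // => s _.
  rewrite -mulr_sumr (_ : \sum_l u (s l) = 0) ?mulr0 //.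
  by rewrite -[RHS]u0 [RHS](reindex_inj (@perm_inj _ s)).
(* The row consists of the diagonal term, a sum of squares, and of one copy of [C] for each
   [l != j]; such an [l] exists, namely [k], so [C] takes the sign opposite to the diagonal. *)
move: rowsum0; rewrite (bigD1 j) //= (eq_bigr _ cE) sumr_cond_const.
move/eqP; rewrite addr_eq0 => /eqP diagE.
have d0 : (0 < #|[pred l | l != j]|)%N by apply/card_gt0P; exists k; rewrite inE eq_sym.
rewrite -(pmulrn_lle0 _ d0) -oppr_ge0 -diagE.
by apply: sumr_ge0 => s _; rewrite -expr2 sqr_ge0.
Qed.

Lemma card_same_group n K M (i : 'I_n) : (0 < K)%N -> n = (K * M)%N ->
  #|[pred j : 'I_n | (j %/ K == i %/ K)%N]| = K.
Proof.
move=> K0 nE; have iM : (i %/ K < M)%N by rewrite ltn_divLR // mulnC -nE.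
by rewrite -[RHS](card_group K0 nE iM); apply: eq_card => x; rewrite !inE.
Qed.

Lemma sum_perm_group_avg_le n K M (u : 'I_n -> R) :
  (0 < K)%N -> n = (K * M)%N -> \sum_i u i = 0 ->
  \sum_(s : 'S_n) \sum_(i < n)
     ((\sum_(j < n | (j %/ K == i %/ K)%N) u (s j)) / K%:R) ^+ 2 <=
  n`!%:R / K%:R * \sum_i u i ^+ 2.
Proof.
move=> K0 nE u0; have K1 : K%:R != 0 :> R by rewrite pnatr_eq0 -lt0n.
have diag_le (i : 'I_n) :
    \sum_(s : 'S_n) (\sum_(j < n | (j %/ K == i %/ K)%N) u (s j)) ^+ 2 <=
    \sum_(j < n | (j %/ K == i %/ K)%N) \sum_(s : 'S_n) u (s j) ^+ 2.
  under eq_bigr do rewrite expr2 big_distrlr.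
  rewrite exchange_big; apply: ler_sum => j ji /=.
  rewrite exchange_big (bigD1 j) //= gerDl.
  apply: sumr_le0 => k /andP[_ kj].
  by apply: sum_perm_cross_le0; rewrite // eq_sym.
(* Each [j] is counted once for each of the [K] positions [i] in its group, and every [s] preserves
   the sum of squares. *)
have totalE : \sum_(i < n) \sum_(j < n | (j %/ K == i %/ K)%N)
    \sum_(s : 'S_n) u (s j) ^+ 2 = K%:R * (n`!%:R * \sum_i u i ^+ 2).
  rewrite (exchange_big_dep xpredT) //=.
  under eq_bigr => j _.
    under eq_bigl do rewrite eq_sym.
    rewrite sumr_cond_const (card_same_group _ K0 nE) -mulr_natl; over.
  rewrite -mulr_sumr exchange_big; congr (_ * _).
  rewrite (eq_bigr (fun=> \sum_i u i ^+ 2)); last first.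
    by move=> s _; rewrite [RHS](reindex_inj (@perm_inj _ s)).
  by rewrite sumr_const card_Sn mulr_natl.
rewrite exchange_big /=.
under eq_bigr do under eq_bigr do rewrite expr_div_n.
under eq_bigr do rewrite -mulr_suml.
rewrite -mulr_suml.
(* Squaring the averages costs [K ^ 2] and the multiplicity in [totalE] gives back one [K], which
   leaves the factor [1 / K]. *)
apply: (@le_trans _ _ (K%:R * (n`!%:R * \sum_i u i ^+ 2) / K%:R ^+ 2)).
  rewrite -totalE ler_pM2r ?invr_gt0 ?exprn_gt0 ?ltr0n //.
  by apply: ler_sum => i _; exact: diag_le.
by rewrite le_eqVlt; apply/orP; left; apply/eqP; field.
Qed.

Lemma sum_potential_step_le n K M t (v : t.-tuple 'S_n) :
  (0 < n)%N -> (0 < K)%N -> n = (K * M)%N ->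
  \sum_(p : 'S_n) potential (posterior R K [tuple of rcons v p]) <=
  n`!%:R / K%:R * potential (posterior R K v).
Proof.
move=> n0 K0 nE.
have n1 : n%:R != 0 :> R by rewrite pnatr_eq0 -lt0n.
have K1 : K%:R != 0 :> R by rewrite pnatr_eq0 -lt0n.
rewrite [potential (posterior R K v)]potentialE ?posterior_sum //.
set u := fun i => posterior R K v i - n%:R^-1.
have u0 : \sum_i u i = 0.
  by rewrite sumrB posterior_sum // sumr_const card_ord -[_ *+ n]mulr_natl divff // subrr.
apply: le_trans (sum_perm_group_avg_le K0 nE u0); rewrite le_eqVlt; apply/orP; left.
(* [posterior_step] reads the old weights through the inverse of the ordering, hence the reindexing
   by inversion. Subtracting [1 / n] commutes with averaging because each group has exactly [K]
   positions. *)
apply/eqP; rewrite [RHS](reindex_inj invg_inj) /=; apply: eq_bigr => p _.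
rewrite potentialE ?posterior_sum //; apply: eq_bigr => i _; congr (_ ^+ 2).
rewrite (posterior_step R v p i K0 nE) sumrB sumr_cond_const (card_same_group _ K0 nE).
by rewrite mulrBl -(mulr_natr n%:R^-1) mulfK.
Qed.

Lemma sum_runs_rcons n K t (X : t.+1.-tuple (round n) -> R) :
  \sum_(r in runs n K t.+1) X r =
  \sum_(r in runs n K t) \sum_(p : 'S_n) \sum_(h in group_shuffles n K)
    X [tuple of rcons r (p, h)].
Proof.
rewrite (reindex _ (onW_bij _ (rcons_tuple_bij _ _))) /=.
rewrite (eq_bigl (fun p : t.-tuple (round n) * round n =>
   (p.1 \in runs n K t) && (p.2.2 \in group_shuffles n K))); last first.
  by move=> p; rewrite ![_ \in runs _ _ _]inE all_rcons andbC.
rewrite -(pair_big_dep (mem (runs n K t))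
  (fun _ (q : round n) => q.2 \in group_shuffles n K)
  (fun r q => X [tuple of rcons r q])) /=.
apply: eq_bigr => r _.
rewrite (pair_big_dep xpredT (fun _ => mem (group_shuffles n K))
  (fun p h => X [tuple of rcons r (p, h)])) /=.
by apply: eq_big => [] [].
Qed.

(** Induction on [t] with unnormalized sums: splitting off the last round leaves the earlier view
    fixed, so the one-round contraction applies run by run. *)
Lemma sum_Phi_le n K M t : (0 < n)%N -> (0 < K)%N -> n = (K * M)%N ->
  \sum_(r in runs n K t) @Phi R n K t r <= K%:R ^- t * #|runs n K t|%:R.
Proof.
move=> n0 K0 nE; elim: t => [|t IH].
  (* Before any round the weights are a point mass, with potential [1 - 1 / n]. *)
  rewrite expr0 invr1 mul1r -sumr_const; apply: ler_sum => r _.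
  rewrite /Phi /potential (bigD1 (Ordinal n0)) //= posterior0 expr1n.
  rewrite big1 ?addr0 ?gerBl ?invr_ge0 // => i.
  by rewrite posterior0 -val_eqE /= => /negPf ->; rewrite expr0n.
(* The count of runs is the sum of the constant 1, so the same splitting applies to it. *)
have cardE : #|runs n K t.+1|%:R =
    #|runs n K t|%:R * (n`!%:R * #|group_shuffles n K|%:R) :> R.
  rewrite -[LHS]sumr_const sum_runs_rcons.
  by rewrite !sumr_const card_Sn !mulr_natl.
rewrite sum_runs_rcons cardE.
have step (r : t.-tuple (round n)) :
    \sum_(p : 'S_n) \sum_(h in group_shuffles n K)
      @Phi R n K t.+1 [tuple of rcons r (p, h)] <=
    #|group_shuffles n K|%:R * (n`!%:R / K%:R) * Phi R K r.
  rewrite -mulrA.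
  (* The potential ignores the hidden shuffle [h], so summing over [h] only contributes the number
     of group shuffles. *)
  have viewE p h : view [tuple of rcons r (p, h)] = [tuple of rcons (view r) p].
    by apply/val_inj; rewrite /= map_rcons.
  rewrite /Phi; under eq_bigr do under eq_bigr do rewrite viewE.
  under eq_bigr do rewrite sumr_const -mulr_natl.
  rewrite -mulr_sumr ler_wpM2l //.
  exact: sum_potential_step_le nE.
apply: le_trans (ler_sum _ (fun r _ => step r)) _.
rewrite -mulr_sumr; apply: le_trans (ler_wpM2l _ IH) _.
  by rewrite !mulr_ge0 ?invr_ge0.
rewrite exprSr invfM le_eqVlt; apply/orP; left; apply/eqP.
by ring.
Qed.

Lemma expectation_Phi_le n K M t : (0 < n)%N -> (0 < K)%N -> n = (K * M)%N ->
  expectation K (@Phi R n K t) <= K%:R ^- t.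
Proof.
move=> n0 K0 nE; rewrite /expectation ler_pdivrMr ?ltr0n ?runs_gt0 //.
exact: sum_Phi_le nE.
Qed.

End Contraction.

(** Write [x ^ b] as [(x ^ (1 / c)) ^ (b * c)] and replace the base by [y]; rounding the exponent up
    is harmless since [1 <= y]. *)
Lemma powR_le_expr_ceil (R : realType) (x y b c : R) :
  0 <= b -> 1 <= c -> 0 <= x -> 1 <= y -> x `^ c^-1 <= y ->
  x `^ b <= y ^+ `|Num.ceil (b * c)|%N.
Proof.
move=> b0 c1 x0 y1 xy.
have c0 : 0 < c by exact: lt_le_trans c1.
have bc0 : 0 <= b * c by rewrite mulr_ge0 // ltW.
have y0 : 0 <= y by exact: le_trans y1.
have -> : x `^ b = (x `^ c^-1) `^ (b * c).
  by rewrite -powRrM mulrCA mulVf ?mulr1 // gt_eqF.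
apply: le_trans (ge0_ler_powR bc0 _ _ xy) _; rewrite ?nnegrE ?powR_ge0 //.
rewrite -powR_mulrn //; apply: ler_powR => //.
(* The absolute value turns the integer ceiling into a natural number; it changes nothing because
   [b * c] is nonnegative. *)
rewrite natr_absz ger0_norm; first exact: Num.Theory.ceil_ge.
by rewrite -(ler_int R); apply: le_trans bc0 (Num.Theory.ceil_ge _).
Qed.

Theorem theorem1 (R : realType) (n K M : nat)
    (n_ge1 : (1 <= n)%N) (K_ge1 : (1 <= K)%N) (M_ge1 : (1 <= M)%N)
    (nE : n = (K * M)%N) :
  (forall t : nat, expectation K (@Phi R n K t) <= K%:R ^- t) /\
  (forall c b : R, 1 <= c -> 1 <= b -> n%:R `^ (c^-1) <= K%:R ->
     expectation K (@Phi R n K `|Num.ceil (b * c)|%N) <= 1 / n%:R `^ b).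
Proof.
have bound t : expectation K (@Phi R n K t) <= K%:R ^- t.
  exact: expectation_Phi_le nE.
split=> // c b c1 b1 nK; apply: le_trans (bound _) _.
rewrite div1r lef_pV2 ?posrE ?exprn_gt0 ?powR_gt0 ?ltr0n //.
by apply: powR_le_expr_ceil; rewrite ?ler1n // (le_trans ler01).
Qed.
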